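(* Let $(\chi_n)_{n\ge1}$, $f$, $a$, $H$, $f^H$, $b_1$, $F$, $b$ be as in the context, with $b_1\ge b$. Let $l>0$ satisfy $$l<\min\{H-f^H,\;F(a)\}\qquad\text{and}\qquad l<b-f(b)=-F(b),$$ define $u_l:=\sup\{u<a: F(u)<l\}$ and $v_l:=\inf\{v>b: F(v)>-l\}$, and suppose that $F$ increases on $[v_l,u_l]$. Let $x_0\in(v_l,u_l)$ and let $K_1,K_2,\lambda_i,\mu_i$ be defined from $x_0$ as in the context. Then the solution of $x_{n+1}=\max\{f(x_n)+l\chi_{n+1},0\}$, $n=0,1,2,\dots$, with initial value $x_0$ persists with a positive probability $$P_p(x_0)\ge\prod_{i=1}^{K_1}\lambda_i$$ and eventually belongs to $[0,b]$ with a positive probability $$P_e(x_0)\ge\prod_{i=1}^{K_2}\mu_i .$$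
   Context: $(\chi_n)_{n\ge1}$ is a sequence of independent identically distributed continuous real random variables with zero mean on a complete probability space $(\Omega,\mathcal F,\mathbb P)$, whose common density $\phi$ satisfies $\phi(x)>0$ for $x\in(-1,1)$ and $\phi(x)=0$ for $x\notin[-1,1]$; $\chi$ denotes a random variable with this law. $f:[0,\infty)\to[0,\infty)$ is continuous, $f(0)=0$, $f(x)>0$ for $x>0$, and there are fixed positive numbers $a<H$ such that (1) $f^H:=\max_{x\in[0,H]}f(x)<H$; (2) $f(x)>f(a)>a$ for all $x\in(a,H]$. Moreover $b_1>0$ is a point such that $f(x)<x$ and $f(x)\le f(b_1)$ for all $x\in(0,b_1)$. $F(x):=f(x)-x$ for $x\in[0,\infty)$, and $b:=\min\{\beta>0:\ F(\beta)=\min_{x\in[0,a]}F(x)\}$ (with $\beta$ ranging over $(0,a]$). A solution $(x_n)$ is persistent (persists) if there exist $n_0\in\mathbb N$ and $c>0$ such that $x_n>c$ for all $n\ge n_0$. The initial value $x_0$ is deterministic; $[t]$ is the integer part of $t\ge 0$. For $x_0\in(v_l,u_l)$ put $$\varepsilon:=\frac{l+F(x_0)}2,\quad K_1:=\Big[\frac{u_l-x_0}{\varepsilon}\Big]+1,\qquad \delta:=\frac{l-F(x_0)}2,\quad K_2:=\Big[\frac{x_0-v_l}{\delta}\Big]+1,$$ $$\varepsilon_i:=\frac{l+2F(x_0+(i-1)\varepsilon)-F(x_0)}{2l},\quad i=1,\dots,K_1,$$ $$\delta_i:=\frac{l-2F(x_0-(i-1)\delta)+F(x_0)}{2l},\quad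 i=1,\dots,K_2,$$ $$\lambda_i:=\mathbb P\{\chi>1-\varepsilon_i\}=\int_{\max\{-1,1-\varepsilon_i\}}^1\phi(t)\,dt,\qquad \mu_i:=\mathbb P\{\chi<-1+\delta_i\}=\int_{-1}^{\min\{-1+\delta_i,1\}}\phi(t)\,dt .$$
   Formalization: ''Eventually belongs to [0,b]'' is proved as reaching [0,b] under the stated hypotheses; remaining in [0,b] for all large n, which can fail as stated, is proved with the same bound under the extra assumption f(x) ≤ f(b) on (0,b). *)

(* Defs.v *)
From HB Require Import structures.
From mathcomp Require Import all_boot all_order all_algebra.
From mathcomp Require Import all_classical all_reals all_analysis.
Set Implicit Arguments.
Unset Strict Implicit.
Unset Printing Implicit Defensive.
Import Order.TTheory GRing.Theory Num.Theory.
Import numFieldNormedType.Exports.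
Local Open Scope classical_set_scope.
Local Open Scope ring_scope.

Section Extrema.
Context {R : realType}.

Definition is_min (A : set R) (m : R) : Prop := A m /\ lbound A m.
Definition is_max (A : set R) (m : R) : Prop := A m /\ ubound A m.

End Extrema.

Section Noise.
Context {d : measure_display} {T : measurableType d} {R : realType}.
Variable P : probability T R.

Definition mutually_independent (X : nat -> {RV P >-> R}) : Prop :=
  forall (s : seq nat) (A : nat -> set R), uniq s ->
    (forall i, i \in s -> measurable (A i)) ->
    P (\bigcap_(i in [set` s]) (X i @^-1` A i)) =
    (\prod_(i <- s) P (X i @^-1` A i))%E.

Definition has_density (X : {RV P >-> R}) (phi : R -> R) : Prop :=
  [/\ measurable_fun setT phi, (forall x, 0 <= phi x) &
      forall A : set R, measurable A ->
        P (X @^-1` A) = (\int[lebesgue_measure]_(x in A) (phi x)%:E)%E].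

(* The term X n stands for chi_(n+1): indices start from 0 so that no
   hypothesis is made on a variable chi_0. *)
Definition noise (X : nat -> {RV P >-> R}) (phi : R -> R) : Prop :=
  [/\ mutually_independent X,
      (forall n, has_density (X n) phi),
      (forall n, 'E_P[X n] = 0)%E,
      (forall x : R, -1 < x < 1 -> 0 < phi x) &
      (forall x : R, ~~ (-1 <= x <= 1) -> phi x = 0)].

End Noise.

Section Equation.
Context {R : realType}.

(* A map [0, oo) -> [0, oo) is represented by a total function f : R -> R of
   which only the values on [0, oo) are constrained or used. *)
Definition half_line_map (f : R -> R) : Prop :=
  [/\ {within `[0, +oo[, continuous f}, f 0 = 0 &
      forall x : R, 0 < x -> 0 < f x].

Definition Fdiff (f : R -> R) (x : R) : R := f x - x.

Definition is_bmin (f : R -> R) (a b : R) : Prop :=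
  is_min [set beta | 0 < beta <= a /\
                     is_min (Fdiff f @` `[0, a]) (Fdiff f beta)] b.

Definition u_ (f : R -> R) (a l : R) : R :=
  sup [set u | 0 <= u < a /\ Fdiff f u < l].

Definition v_ (f : R -> R) (b l : R) : R :=
  inf [set v | b < v /\ - l < Fdiff f v].

Fixpoint solution (f : R -> R) (l x0 : R) (xi : nat -> R) (n : nat) : R :=
  if n is m.+1
  then Num.max (f (solution f l x0 xi m) + l * xi m) 0
  else x0.

Definition persistent (x : nat -> R) : Prop :=
  exists n0 : nat, exists2 c : R, 0 < c & forall n, (n0 <= n)%N -> c < x n.

(* With A = [0, b], these are the two senses of "eventually belongs to [0, b]":
   getting into [0, b], and lying in [0, b] from some index on.  They agree
   almost surely when f(x) <= f(b) on (0, b), since then f(x) + l < b on [0, b].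
   Without that inequality f may exceed f(b) just to the left of b, the noise
   can push the solution back above b infinitely often, and the second event
   can have probability 0. *)
Definition enters (A : set R) (x : nat -> R) : Prop :=
  exists n : nat, A (x n).

Definition stays_eventually (A : set R) (x : nat -> R) : Prop :=
  exists n0 : nat, forall n, (n0 <= n)%N -> A (x n).

Definition eps (f : R -> R) (l x0 : R) : R := (l + Fdiff f x0) / 2.
Definition K1 (f : R -> R) (a l x0 : R) : nat :=
  (Num.truncn ((u_ f a l - x0) / eps f l x0) + 1)%N.
Definition eps_ (f : R -> R) (l x0 : R) (i : nat) : R :=
  (l + 2 * Fdiff f (x0 + (i%:R - 1) * eps f l x0) - Fdiff f x0) / (2 * l).

Definition delta (f : R -> R) (l x0 : R) : R := (l - Fdiff f x0) / 2.
Definition K2 (f : R -> R) (b l x0 : R) : nat :=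
  (Num.truncn ((x0 - v_ f b l) / delta f l x0) + 1)%N.
Definition delta_ (f : R -> R) (l x0 : R) (i : nat) : R :=
  (l - 2 * Fdiff f (x0 - (i%:R - 1) * delta f l x0) + Fdiff f x0) / (2 * l).

End Equation.

Section Weights.
Context {d : measure_display} {T : measurableType d} {R : realType}.
Variables (P : probability T R) (chi : {RV P >-> R}).

Definition lambda_ (f : R -> R) (l x0 : R) (i : nat) : \bar R :=
  P [set w | 1 - eps_ f l x0 i < chi w].
Definition mu_ (f : R -> R) (l x0 : R) (i : nat) : \bar R :=
  P [set w | chi w < -1 + delta_ f l x0 i].

End Weights.

(* Main.v *)
(** Write [F x = f x - x]; on [[v, u]] the map [F] is increasing with values
    in [[-l, l]].  The thresholds are calibrated so that a noise value above
    [1 - eps_i] moves every state of [[x0 + (i-1) eps, u]] above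
    [x0 + i eps]: after [K1] such values the state exceeds [u], and since
    [F >= l] on [(u, a]] and [f > a + l] on [(a, H]], no noise can bring it back.
    Symmetrically, [K2] noise values below [-1 + delta_i] bring the state below
    [v].  As [F <= -l] on [(b, v)], the state is then non-increasing as long as
    it exceeds [b], and it loses at least [l] at each negative noise value; almost
    surely there are infinitely many of those, so that [[0, b]] is reached. *)
Require Import Defs.
From HB Require Import structures.
From mathcomp Require Import all_boot all_order all_algebra.
From mathcomp Require Import all_classical all_reals all_analysis.
From mathcomp Require Import measurable_realfun ring lra.
Set Implicit Arguments.
Unset Strict Implicit.
Unset Printing Implicit Defensive.
Import Order.TTheory GRing.Theory Num.Theory.
Import numFieldNormedType.Exports.
Local Open Scope classical_set_scope.
Local Open Scope ring_scope.

(** * Extremality of [u_] and [v_], and the resulting bounds on [F] *)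

Section ExtremalPoints.
Context {R : realType}.
Variables (f : R -> R) (a b l : R).

Lemma Fdiff_above_u (x : R) : 0 <= x -> u_ f a l < x < a -> l <= Fdiff f x.
Proof.
move=> x0 /andP[ux xa]; rewrite leNgt; apply/negP => Fx.
suff : x <= u_ f a l by rewrite leNgt ux.
apply: ub_le_sup; last by rewrite /= x0 xa.
by exists a => y /= [/andP[_ /ltW]].
Qed.

(** Serves to obtain the strict bound [F x0 < l], hence a positive [delta]: [F] increases up to
    [u_], so [F x0] is at most its value at such a [y]. The set defining [u_] contains 0, where [F]
    vanishes. *)
Lemma u_gt (x : R) : f 0 = 0 -> 0 < a -> 0 < l -> x < u_ f a l ->
  exists y, [/\ x < y, y <= u_ f a l & Fdiff f y < l].
Proof.
move=> f0 a0 l0 xu; set S := [set u | 0 <= u < a /\ Fdiff f u < l].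
have S0 : S !=set0 by exists 0; rewrite /S/= lexx a0 /Fdiff f0 subrr l0.
have [y Sy xy] := sup_gt S0 xu; exists y; split => //; last by case: Sy.
by apply: ub_le_sup => //; exists a => z /= [/andP[_ /ltW]].
Qed.

Lemma Fdiff_below_v (x : R) : b < x < v_ f b l -> Fdiff f x <= - l.
Proof.
move=> /andP[bx xv]; rewrite leNgt; apply/negP => Fx.
suff : v_ f b l <= x by rewrite leNgt xv.
by apply: ge_inf => //; exists b => y /= [/ltW].
Qed.

(** Mirror image of [u_gt], aimed at [- l < F x0] and a positive [eps]; here [a] witnesses that the
    set defining [v_] is nonempty. *)
Lemma v_lt (x : R) : b < a -> - l < Fdiff f a -> v_ f b l < x ->
  exists y, [/\ y < x, v_ f b l <= y & - l < Fdiff f y].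
Proof.
move=> ba Fa vx; set S := [set v | b < v /\ - l < Fdiff f v].
have S0 : S !=set0 by exists a.
have [y Sy xy] := inf_lt S0 vx; exists y; split => //; last by case: Sy.
by apply: ge_inf => //; exists b => z /= [/ltW].
Qed.

Lemma v_ge : b < a -> - l < Fdiff f a -> b <= v_ f b l.
Proof.
move=> ba Fa; apply: lb_le_inf; first by exists a.
by move=> z /= [/ltW].
Qed.

End ExtremalPoints.

(** * Pathwise analysis for a fixed noise sequence with values in [[-1, 1]] *)

Section Trajectories.
Context {R : realType}.
Variables (f : R -> R) (l x0 : R) (xi : nat -> R).
Hypotheses (l_gt0 : 0 < l) (xiP : forall n, -1 <= xi n <= 1).
Local Notation x := (solution f l x0 xi).
Local Notation F := (Fdiff f).

Lemma solution_ge0 n : 0 <= x0 -> 0 <= x n.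
Proof. by case: n => //= n _; rewrite le_max lexx orbT. Qed.

Lemma noise_bound n : - l <= l * xi n <= l.
Proof.
have := xiP n; rewrite -(ler_pM2l l_gt0) -(ler_pM2l l_gt0 _ 1).
by rewrite mulrN1 mulr1 => /andP[-> ->].
Qed.

Lemma solution_bound (H fH : R) : 0 <= x0 <= H -> l < H - fH -> 0 < fH ->
  (forall y, 0 <= y <= H -> f y <= fH) -> forall n, x n <= H.
Proof.
move=> /andP[x0_ge0 x0H] lH fH0 fHP; elim=> // n IH /=.
have := fHP (x n); rewrite solution_ge0 // IH => /(_ isT) ?.
have := noise_bound n; rewrite ge_max => ?; apply/andP; split; lra.
Qed.

(** * Climbing above [u] and remaining there *)

Section Persistence.
Variables (a H : R).
Hypotheses (xH : forall n, x n <= H) (Fa : l < F a)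
  (faH : forall y, a < y <= H -> f a < f y)
  (x0_ge0 : 0 <= x0) (ua : u_ f a l <= a)
  (F_homo : {in `[x0, u_ f a l] &, {homo F : y z / y <= z}})
  (Fx0 : - l < F x0).
Local Notation u := (u_ f a l).
Local Notation eps := (eps f l x0).

(** The worst noise subtracts [l]. From a state [y] in [(u, a)] this is compensated by [F y >= l],
    so the state does not decrease; from [y >= a] the next state is at least [f a - l > a >= u]. *)
Lemma solution_stays_above m n : (m <= n)%N -> u < x m -> u < x n.
Proof.
move=> mn um; rewrite -(subnKC mn); elim: (n - m)%N => [|k IH]; first by rewrite addn0.
rewrite addnS /= lt_max; apply/orP; left.
have := noise_bound (m + k)%N; have := solution_ge0 (m + k)%N x0_ge0.
move: (x _) (IH) (xH (m + k)) => y uy yH y0 yxi.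
have [ya|ya|->] := ltgtP y a.
- have := Fdiff_above_u (f := f) (a := a) (l := l) y0.
  rewrite uy ya /Fdiff => /(_ isT); lra.
- have := @faH y; rewrite ya yH => /(_ isT).
  have := Fa; have := ua; rewrite /Fdiff; lra.
- have := Fa; rewrite /Fdiff; move: ua; lra.
Qed.

Lemma solution_climbs n : (n <= K1 f a l x0)%N ->
  (forall i, (i < n)%N -> 1 - eps_ f l x0 i.+1 < xi i) ->
  u < x n \/ x0 + n%:R * eps <= x n.
Proof.
have eps0 : 0 < eps by have := Fx0; rewrite /Defs.eps; lra.
elim: n => [|n IH] nK xiK; first by right; rewrite mul0r addr0.
have [i|ux|yx] := IH (ltnW nK); first by move=> /leqW/xiK.
  by left; exact: solution_stays_above ux.
have [xu|ux] := leP (x n) u; last by left; exact: solution_stays_above ux.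
right; rewrite /= le_max; apply/orP; left.
set y := x0 + n%:R * eps in yx.
have x0y : x0 <= y by rewrite lerDl mulr_ge0// ltW.
have Fyx : F y <= F (x n).
  by apply: F_homo => //; rewrite in_itv /= ?x0y ?xu ?(le_trans x0y yx) ?(le_trans yx xu).
(* At index [n.+1], [eps_] samples [F] exactly at [y], and [l * (1 - eps_)] equals [eps - F y]. The
   next state thus exceeds [x n + F (x n) + eps - F y], which is at least [y + eps]. *)
have := xiK n (leqnn _).
rewrite -(ltr_pM2l l_gt0) /eps_ -(natr1 n) addrK -/y (mulrDl n%:R) mul1r addrA.
have -> : l * (1 - (l + 2 * F y - F x0) / (2 * l)) = l - (l + 2 * F y - F x0) / 2.
  by field; rewrite gt_eqF.
move: Fyx; rewrite -/y /Defs.eps /Fdiff; lra.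
Qed.

(** The sampling points used before step [K1] lie in [[x0, u]], where [F >= F x0], so the numerator
    is at least [l + F x0 > 0]. This positivity is what gives each threshold event a positive
    probability. *)
Lemma eps_gt0 i : (i < K1 f a l x0)%N -> x0 < u -> 0 < eps_ f l x0 i.+1.
Proof.
have eps0 : 0 < eps by have := Fx0; rewrite /Defs.eps; lra.
rewrite /K1 addn1 ltnS /eps_ -(natr1 i) addrK -/eps => iK x0u; set y := x0 + _.
have yu : y <= u.
  rewrite -lerBrDl -ler_pdivlMr//.
  apply: (@le_trans _ _ (Num.truncn ((u - x0) / eps))%:R).
    by rewrite ler_nat.
  by rewrite truncn_le// divr_ge0// ltW// subr_gt0.
have x0y : x0 <= y by rewrite lerDl mulr_ge0// ltW.
have : F x0 <= F y by apply: F_homo; rewrite // in_itv /= ?lexx ?x0y// ltW.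
move=> Fx0y; apply: divr_gt0; last by rewrite mulr_gt0.
by move: Fx0y Fx0; lra.
Qed.

Lemma persistent_solution : 0 < u ->
  (forall i, (i < K1 f a l x0)%N -> 1 - eps_ f l x0 i.+1 < xi i) ->
  persistent x.
Proof.
move=> u0 xiK; have eps0 : 0 < eps by have := Fx0; rewrite /Defs.eps; lra.
(* The [+ 1] in [K1] makes [K1 * eps] strictly larger than [u - x0], so the climb ends above [u],
   and [u] itself can be the persistence constant. *)
exists (K1 f a l x0), u => // n Kn; apply: solution_stays_above Kn _.
have [//|] := solution_climbs (leqnn _) xiK; apply: lt_le_trans.
rewrite -ltrBlDl -ltr_pdivrMr// /K1 addn1.
exact: truncnS_gt.
Qed.

End Persistence.

(** * Descending below [v] and reaching [[0, b]] *)

Section Entry.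
Variables (a b : R).
Hypotheses (b_gt0 : 0 < b)
  (F_homo : {in `[v_ f b l, x0] &, {homo F : y z / y <= z}})
  (bx0 : v_ f b l < x0)
  (Fx0 : F x0 < l).
Local Notation v := (v_ f b l).
Local Notation delta := (delta f l x0).

(** The first alternative covers truncation at 0; without truncation, [F <= - l] on [(b, v)] absorbs
    even the largest noise. *)
Lemma solution_stays_below n :
  b < x n < v -> x n.+1 <= b \/ x n.+1 <= x n + (l * xi n - l).
Proof.
move=> /Fdiff_below_v; rewrite /Fdiff => Fx; have := noise_bound n => xin.
have [fx|fx] := leP (f (x n) + l * xi n) 0.
  by left; rewrite /= (max_idPr fx) ltW.
by right; rewrite /= (max_idPl (ltW fx)); lra.
Qed.

(** Mirror image of [solution_climbs]. It is used while refuting that [[0, b]] is never entered, so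
    [b < x i] is available; as [b > 0], it rules out truncation at 0. *)
Lemma solution_descends n : (n <= K2 f b l x0)%N -> (forall i, b < x i) ->
  (forall i, (i < n)%N -> xi i < -1 + delta_ f l x0 i.+1) ->
  x n < v \/ x n <= x0 - n%:R * delta.
Proof.
have delta0 : 0 < delta by have := Fx0; rewrite /Defs.delta; lra.
move=> nK bx; elim: n nK => [|n IH] nK xiK; first by right; rewrite mul0r subr0.
have x'E : x n.+1 = f (x n) + l * xi n.
  have := bx n.+1; rewrite /= lt_max => /orP[fx|]; last by rewrite ltNge (ltW b_gt0).
  by rewrite (max_idPl _)// ltW// (lt_trans b_gt0).
have below : x n < v -> x n.+1 < v.
  move=> xv; have := @solution_stays_below n; rewrite bx xv => /(_ isT)[].
    by rewrite leNgt bx.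
  have := noise_bound n; lra.
have [i|xv|xz] := IH (ltnW nK); first by move=> /leqW/xiK.
  by left; exact: below.
have [vx|xv] := leP v (x n); last by left; exact: below.
right; set z := x0 - n%:R * delta in xz.
have zx0 : z <= x0 by rewrite gerBl mulr_ge0// ltW.
have Fxz : F (x n) <= F z.
  by apply: F_homo => //; rewrite in_itv /= ?zx0 ?vx ?(le_trans vx xz) ?(le_trans xz zx0).
(* Here [l * (-1 + delta_)] equals [- delta - F z], so the next state is below [z - delta]. *)
have := xiK n (leqnn _).
rewrite -(ltr_pM2l l_gt0) /delta_ -(natr1 n) addrK -/z
  (mulrDl n%:R) mul1r opprD (addrA x0).
have -> : l * (-1 + (l - 2 * F z + F x0) / (2 * l)) = - l + (l - 2 * F z + F x0) / 2.
  by field; rewrite gt_eqF.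
move: Fxz; rewrite x'E -/z /Defs.delta /Fdiff; lra.
Qed.

Lemma delta_gt0 i : (i < K2 f b l x0)%N -> 0 < delta_ f l x0 i.+1.
Proof.
have delta0 : 0 < delta by have := Fx0; rewrite /Defs.delta; lra.
rewrite /K2 addn1 ltnS /delta_ -(natr1 i) addrK -/delta => iK; set z := x0 - _.
have vz : v <= z.
  rewrite lerBrDl -lerBrDr -ler_pdivlMr//.
  apply: (@le_trans _ _ (Num.truncn ((x0 - v) / delta))%:R).
    by rewrite ler_nat.
  by rewrite truncn_le// divr_ge0// ltW// subr_gt0.
have zx0 : z <= x0 by rewrite gerBl mulr_ge0// ltW.
have : F z <= F x0 by apply: F_homo; rewrite // in_itv /= ?lexx ?zx0 ?vz// ltW.
move=> Fzx0; apply: divr_gt0; last by rewrite mulr_gt0.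
by move: Fzx0 Fx0; lra.
Qed.

Lemma solution_enters : 0 <= x0 ->
  (forall m, exists2 n, (m <= n)%N & xi n < 0) ->
  (forall i, (i < K2 f b l x0)%N -> xi i < -1 + delta_ f l x0 i.+1) ->
  enters `[0, b] x.
Proof.
move=> x0_ge0 xi_neg xiK; apply: contrapT => /forallNP nx.
have {nx} bx n : b < x n.
  by rewrite ltNge; apply/negP => xb; apply: (nx n); rewrite /= in_itv /= solution_ge0.
have delta0 : 0 < delta by have := Fx0; rewrite /Defs.delta; lra.
have xKv : x (K2 f b l x0) < v.
  have [//|] := solution_descends (leqnn _) bx xiK; move/le_lt_trans; apply.
  rewrite ltrBlDr -ltrBlDl -ltr_pdivrMr// /K2 addn1; exact: truncnS_gt.
have xv k : x (K2 f b l x0 + k)%N < v.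
  elim: k => [|k IH]; rewrite ?addn0// addnS.
  have := @solution_stays_below (K2 f b l x0 + k); rewrite bx IH => /(_ isT)[|].
    by rewrite leNgt bx.
  have := noise_bound (K2 f b l x0 + k)%N; lra.
have step n : (K2 f b l x0 <= n)%N -> x n.+1 <= x n + (l * xi n - l).
  move=> /subnKC Kn; have := @solution_stays_below n.
  rewrite bx -{1}Kn xv => /(_ isT)[|//].
  by rewrite leNgt bx.
have dec m n : (K2 f b l x0 <= m <= n)%N -> x n <= x m.
  move=> /andP[Km /subnKC <-]; elim: (n - m)%N => [|k IH]; rewrite ?addn0// addnS.
  apply: le_trans (step _ _) _; first by rewrite (leq_trans Km)// leq_addr.
  have := noise_bound (m + k)%N; lra.
have drop k : exists2 n, (K2 f b l x0 <= n)%N & x n <= v - k%:R * l.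
  elim: k => [|k [n Kn xn]]; first by exists (K2 f b l x0); rewrite // mul0r subr0 ltW.
  have [m nm xim] := xi_neg n; exists m.+1; first by rewrite (leq_trans Kn)// leqW.
  have := step m (leq_trans Kn nm); have := dec n m; rewrite Kn nm => /(_ isT).
  have := l_gt0; rewrite -(pmulr_rlt0 _ l_gt0) in xim.
  rewrite -(natr1 k) mulrDl mul1r; lra.
(* With this many drops the bound [v - k * l] is negative, against [b < x n]. *)
have [n _ xn] := drop (Num.truncn (v / l)).+1.
have := truncnS_gt (v / l); rewrite ltr_pdivrMr// => vl.
have := bx n; have := b_gt0; lra.
Qed.

(** [[0, b]] is invariant: there [f y + l <= f b + l < b], so no noise leads out of it. *)
Lemma solution_stays : 0 <= x0 -> l < b - f b ->
  (forall y, 0 <= y <= b -> f y <= f b) ->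
  enters `[0, b] x -> stays_eventually `[0, b] x.
Proof.
move=> x0_ge0 lb fxb [n0]; rewrite /= in_itv /= => /andP[_ xb].
exists n0 => n /subnKC <-; rewrite /= in_itv /= solution_ge0//=.
elim: (n - n0)%N => [|k IH]; rewrite ?addn0// addnS /= ge_max (ltW b_gt0) andbT.
have := fxb (x (n0 + k)%N); rewrite solution_ge0// IH => /(_ isT).
have := noise_bound (n0 + k)%N; move: lb; lra.
Qed.

End Entry.
End Trajectories.

(** * Positive probabilities and almost sure properties of the noise *)

Lemma le_probability_ae d (T : measurableType d) (R : realType)
    (P : probability T R) (A E : set T) : measurable A -> measurable E ->
  (\forall w \ae P, A w -> E w) -> (P A <= P E)%E.
Proof.
(* Adding the exceptional null set [N] to [E] leaves its probability unchanged and turns the almost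
   sure implication into an inclusion. *)
move=> mA mE [N [mN N0 AEN]]; rewrite -(measureU0 mE mN N0).
apply: le_measure; rewrite ?inE//; first exact: measurableU.
move=> w Aw; have [Ew|nE] := pselect (E w); [by left|right; apply: AEN => /=].
by move=> /(_ Aw).
Qed.

Section Noise.
Context {d : measure_display} {T : measurableType d} {R : realType}.
Variable P : probability T R.

Lemma measurable_preimage_RV (X : {RV P >-> R}) (A : set R) :
  measurable A -> measurable (X @^-1` A).
Proof. by move=> mA; rewrite -[X @^-1` A]setTI; exact: measurable_funP. Qed.

(** A zero integral of the nonnegative [phi] would force [phi] to vanish almost everywhere on []r,
    s[], so an interval of positive length would lie in a null set. *)
Lemma has_density_gt0 (X : {RV P >-> R}) (phi : R -> R) (r s : R) :
  has_density X phi -> r < s -> (forall x, r < x < s -> 0 < phi x) ->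
  (0 < P (X @^-1` `]r, s[))%E.
Proof.
move=> [mphi phi0 XE] rs phi_gt0; rewrite lt0e measure_ge0 andbT.
apply/eqP; rewrite XE; last exact: measurable_itv.
under eq_integral do rewrite -[phi _]ger0_norm// -abse_EFin.
have mD : measurable (`]r, s[ : set R) by exact: measurable_itv.
have mf : measurable_fun (`]r, s[ : set R) (fun x => (phi x)%:E).
  by apply/measurable_EFinP; exact: measurable_funTS.
move=> /(iffLR (ae_eq_integral_abs lebesgue_measure mD mf)) [N [mN N0 rsN]].
have : (lebesgue_measure (`]r, s[ : set R) <= lebesgue_measure N)%E.
  apply: le_measure; rewrite ?inE// => x rsx; apply: rsN => /= /(_ rsx) [].
  by apply/eqP; rewrite gt_eqF// phi_gt0//; move: rsx; rewrite /= in_itv.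
rewrite [X in (_ <= X)%E]N0 lebesgue_measure_itv /= lte_fin rs leNgt.
by rewrite -EFinB lte_fin subr_gt0 rs.
Qed.

Lemma has_density_ae_in (X : {RV P >-> R}) (phi : R -> R) (A : set R) :
  has_density X phi -> measurable A -> (forall x, ~ A x -> phi x = 0) ->
  \forall w \ae P, A (X w).
Proof.
move=> [mphi phi_ge0 XE] mA phi0; exists (X @^-1` (~` A)).
have mCA := measurableC mA.
split => //; first exact: measurable_preimage_RV.
rewrite XE//; apply: integral0_eq => x /phi0 ->//.
Qed.

Variables (X : nat -> {RV P >-> R}) (phi : R -> R).
Hypothesis X_noise : noise X phi.

Lemma noise_bounded : \forall w \ae P, forall n, -1 <= X n w <= 1.
Proof.
case: X_noise => _ dX _ _ phi0; apply: ae_foralln => n.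
have := @has_density_ae_in _ _ `[-1, 1] (dX n) (measurable_itv _).
by apply => x /= /negP; exact: phi0.
Qed.

Lemma noise_gt0 (n : nat) (A : set R) (r s : R) : measurable A ->
  -1 <= r -> r < s -> s <= 1 -> `]r, s[ `<=` A -> (0 < P (X n @^-1` A))%E.
Proof.
move=> mA r1 rs s1 rsA; case: X_noise => _ dX _ phi_gt0 _.
apply: (@lt_le_trans _ _ (P (X n @^-1` `]r, s[))).
  apply: has_density_gt0 (dX n) rs _ => x /andP[rx xs].
  by apply: phi_gt0; rewrite (le_lt_trans r1 rx) (lt_le_trans xs s1).
apply: le_measure; rewrite ?inE; [exact: measurable_preimage_RV (measurable_itv _)|
  exact: measurable_preimage_RV|].
by move=> w; exact: rsA.
Qed.

Lemma noise_identically_distributed (n : nat) (A : set R) : measurable A ->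
  P (X n @^-1` A) = P (X 0%N @^-1` A).
Proof.
case: X_noise => _ dX _ _ _ mA; have [_ _ ->//] := dX n.
by have [_ _ ->] := dX 0%N.
Qed.

(** The bounds of the theorem involve [chi 0] alone, so each factor supplied by independence is
    transported to [X 0], all laws having the same density. *)
Lemma noise_iid (m k : nat) (A : nat -> set R) : (forall i, measurable (A i)) ->
  P [set w | forall i, (m <= i < m + k)%N -> A i (X i w)] =
  (\prod_(m <= i < m + k) P (X 0%N @^-1` A i))%E.
Proof.
move=> mA; under eq_bigr => i _ do rewrite -(noise_identically_distributed i)//.
case: X_noise => indX _ _ _ _; rewrite -indX ?iota_uniq//.
by congr (P _); apply/seteqP; split=> w /= H i; have := H i; rewrite /= mem_index_iota.
Qed.

(** Having no negative value from index [m] on means lying in every [B k]. Independence gives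
    [P (B k) = q ^+ k], with [q < 1] because [phi] is positive on [(-1, 0)]; letting [k] grow leaves
    probability 0. *)
Lemma noise_infinitely_often_lt0 :
  \forall w \ae P, forall m, exists2 n, (m <= n)%N & X n w < 0.
Proof.
apply: ae_foralln => m.
pose B k := [set w | forall i, (m <= i < m + k)%N -> `[0, +oo[%classic (X i w)].
have mB k : measurable (B k).
  have -> : B k = \bigcap_(i in [set i | (m <= i < m + k)%N]) (X i @^-1` `[0, +oo[).
    by apply/seteqP; split.
  apply: bigcap_measurableType => i _; exact: measurable_preimage_RV (measurable_itv _).
have mC : measurable (\bigcap_k B k) by exact: bigcapT_measurable.
exists (\bigcap_k B k); split => //; last first.
  move=> w /= nX k _ i /andP[mi _]; rewrite /= in_itv /= andbT leNgt; apply/negP => Xi.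
  by apply: nX; exists i.
pose q := fine (P (X 0%N @^-1` `[0, +oo[)).
have m0 : measurable (X 0%N @^-1` `[0, +oo[).
  by exact: measurable_preimage_RV (measurable_itv _).
have qE : q%:E = P (X 0%N @^-1` `[0, +oo[) by rewrite fineK// fin_num_measure.
have q0 : 0 <= q by rewrite -lee_fin qE.
have q1 : q < 1.
  have := @noise_gt0 0 `]-oo, 0[ (-1) 0 (measurable_itv _).
  rewrite lexx ltrN10 ler01 => /(_ isT isT isT) /(_ _)/wrap[].
    by move=> x /=; rewrite !in_itv /= => /andP[].
  have -> : X 0%N @^-1` `]-oo, 0[ = ~` (X 0%N @^-1` `[0, +oo[).
    by apply/seteqP; split=> w /=; rewrite !in_itv /= andbT ltNge => /negP.
  by rewrite probability_setC// -qE -EFinB lte_fin subr_gt0.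
have PB k : P (B k) = (q ^+ k)%:E.
  rewrite (@noise_iid m k (fun=> `[0, +oo[%classic)); last by move=> _; exact: measurable_itv.
  rewrite -qE big_const_nat addKn; elim: k => [|k /= ->]; first by rewrite expr0.
  by rewrite -EFinM exprS.
have pE : (fine (P (\bigcap_k B k)))%:E = P (\bigcap_k B k).
  by rewrite fineK// fin_num_measure.
suff : P (\bigcap_k B k) = 0 by [].
apply/eqP; rewrite eq_le measure_ge0 andbT -pE lee_fin.
have qk : (fun k => q ^+ k) @ \oo --> (0 : R) by apply: cvg_expr; rewrite ger0_norm.
rewrite -(cvg_lim _ qk)//; apply: limr_ge; first by apply/cvg_ex; exists 0.
apply: nearW => k; rewrite -lee_fin pE -PB; apply: le_measure; rewrite ?inE//.
by move=> w; apply.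
Qed.

(** Common core of all the bounds: an almost sure implication from finitely many noise constraints
    becomes a lower bound on a probability. [A] is indexed from 1, as in the products, and the noise
    from 0, whence the pairing of [A i.+1] with [X i]. *)
Lemma noise_forcing (K : nat) (A : nat -> set R) (E : set T) :
    (forall i, measurable (A i)) -> measurable E ->
    (forall i, (i < K)%N -> 0 < P (X 0%N @^-1` A i.+1))%E ->
    (\forall w \ae P, (forall i, (i < K)%N -> A i.+1 (X i w)) -> E w) ->
  (0 < P E)%E /\ (\prod_(1 <= i < K.+1) P (X 0%N @^-1` A i) <= P E)%E.
Proof.
move=> mA mE A_gt0 AE; rewrite big_add1 /=.
suff leE : (\prod_(0 <= i < K) P (X 0%N @^-1` A i.+1) <= P E)%E.
  split=> //; apply: lt_le_trans leE; rewrite big_nat_cond.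
  elim/big_ind : _ => [|r s r0 s0|i]; first by rewrite lte01.
    exact: mule_gt0.
  by rewrite andbT => /A_gt0.
have := @noise_iid 0 K (fun i => A i.+1) (fun i => mA i.+1); rewrite add0n => <-.
apply: le_probability_ae => //.
rewrite (_ : [set w | _] = \bigcap_(i in [set i | (i < K)%N]) (X i @^-1` A i.+1)).
  by apply: bigcap_measurableType => i _; exact: measurable_preimage_RV.
by apply/seteqP; split.
Qed.

End Noise.

(** * Measurability of the solution and of the three events *)

Section Measurability.
Context {d : measure_display} {T : measurableType d} {R : realType}.
Variables (P : probability T R) (X : nat -> {RV P >-> R}).
Variables (f : R -> R) (l x0 : R).
Hypotheses (f_cont : {within `[0, +oo[, continuous f}) (x0_ge0 : 0 <= x0).
Local Notation x w := (solution f l x0 (fun n => X n w)).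

(** Continuity of [f] is known on the half-line only. Clipping the argument at 0 gives a map
    continuous, hence measurable, on all of [R], and it agrees with [f] along solutions, which are
    nonnegative. *)
Lemma continuous_comp_max0 : continuous (fun y : R => f (Num.max y 0)).
Proof.
move=> y; have y0 : `[0, +oo[%classic (Num.max y 0).
  by rewrite /= in_itv /= andbT le_max lexx orbT.
have /subspace_continuousP/(_ _ y0) := f_cont; apply: cvg_comp.
have max_cont : {for y, continuous ((id : R -> R^o) \max cst 0)}.
  by apply: continuous_max; [exact: cvg_id|exact: cvg_cst].
move=> A /max_cont wA; apply: (@filterS _ (nbhs y) _ _ _ _ wA) => z; apply.
by rewrite /= in_itv /= andbT le_max lexx orbT.
Qed.

Lemma measurable_solution n : measurable_fun setT (fun w => x w n).
Proof.
elim: n => [|n IH] /=; first exact: measurable_cst.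
apply: measurable_maxr; last exact: measurable_cst.
apply: measurable_funD; last first.
  apply: measurable_funM; [exact: measurable_cst|exact: measurable_funP].
rewrite (_ : (fun w => _) = (fun y => f (Num.max y 0)) \o (fun w => x w n)).
  apply: measurableT_comp IH; apply: continuous_measurable_fun.
  exact: continuous_comp_max0.
by apply/funext => w /=; rewrite (max_idPl _)// solution_ge0.
Qed.

Lemma measurable_solution_in (A : set R) n : measurable A ->
  measurable [set w | A (x w n)].
Proof.
by move=> mA; rewrite -[X in measurable X]setTI; exact: measurable_solution.
Qed.

Lemma measurable_persistent : measurable [set w | persistent (x w)].
Proof.
(* The constant [c] ranges over an uncountable set; restricting it to inverses of positive integers
   makes the union countable. *)
have -> : [set w | persistent (x w)] =
    \bigcup_m \bigcup_k \bigcap_(n in [set n | (m <= n)%N])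
      [set w | `]k.+1%:R^-1, +oo[%classic (x w n)].
  apply/seteqP; split => w /=.
    move=> [m [c c0 xc]]; exists m => //; exists (Num.truncn c^-1) => // n mn /=.
    rewrite in_itv /= andbT; apply: lt_trans (xc n mn).
    by rewrite invf_plt ?posrE// truncnS_gt.
  move=> [m _ [k _ xk]]; exists m, k.+1%:R^-1; first by rewrite invr_gt0.
  by move=> n /xk /=; rewrite in_itv /= andbT.
apply: bigcupT_measurable => m; apply: bigcupT_measurable => k.
by apply: bigcap_measurableType => n _; exact: measurable_solution_in (measurable_itv _).
Qed.

Lemma measurable_enters (A : set R) : measurable A ->
  measurable [set w | enters A (x w)].
Proof.
move=> mA; have -> : [set w | enters A (x w)] = \bigcup_n [set w | A (x w n)].
  by apply/seteqP; split => w /= [n]; exists n.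
by apply: bigcupT_measurable => n; exact: measurable_solution_in.
Qed.

Lemma measurable_stays_eventually (A : set R) : measurable A ->
  measurable [set w | stays_eventually A (x w)].
Proof.
move=> mA; have -> : [set w | stays_eventually A (x w)] =
    \bigcup_m \bigcap_(n in [set n | (m <= n)%N]) [set w | A (x w n)].
  by apply/seteqP; split => w /= [m]; [exists m|move=> _; exists m].
apply: bigcupT_measurable => m; apply: bigcap_measurableType => n _.
exact: measurable_solution_in.
Qed.

End Measurability.

(** * Assembly of the probability bounds *)

Unset Implicit Arguments.

Theorem theorem4p7 (R : realType) (d : measure_display) (T : measurableType d)
  (P : probability T R) (hP : measure_is_complete P)
  (chi : nat -> {RV P >-> R}) (phi : R -> R) (hchi : noise chi phi)
  (f : R -> R) (hf : half_line_map f)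
  (a H fH : R) (ha : 0 < a) (haH : a < H)
  (hfH : is_max (f @` `[0, H]) fH) (hfHH : fH < H)
  (hfa : a < f a) (hfa' : forall x : R, a < x <= H -> f a < f x)
  (b1 : R) (hb1 : 0 < b1)
  (hfb1 : forall x : R, 0 < x < b1 -> f x < x /\ f x <= f b1)
  (b : R) (hb : is_bmin f a b) (hbb1 : b <= b1)
  (l : R) (hl : 0 < l)
  (hl1 : l < Num.min (H - fH) (Fdiff f a)) (hl2 : l < b - f b)
  (hF : {in `[v_ f b l, u_ f a l] &, {homo Fdiff f : x y / x <= y}})
  (x0 : R) (hx0 : v_ f b l < x0 < u_ f a l) :
  let x (w : T) := solution f l x0 (fun n => chi n w) in
  let persist_bound :=
    (\prod_(1 <= i < (K1 f a l x0).+1) lambda_ (chi 0%N) f l x0 i)%E in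
  let entry_bound :=
    (\prod_(1 <= i < (K2 f b l x0).+1) mu_ (chi 0%N) f l x0 i)%E in
  let Ppersist := P [set w | persistent (x w)] in
  let Penter := P [set w | enters `[0, b] (x w)] in
  let Pstay := P [set w | stays_eventually `[0, b] (x w)] in
  [/\ (0 < Ppersist)%E /\ (persist_bound <= Ppersist)%E,
      (0 < Penter)%E /\ (entry_bound <= Penter)%E &
      (forall y : R, 0 < y < b -> f y <= f b) ->
      (0 < Pstay)%E /\ (entry_bound <= Pstay)%E].
Proof.
move: hb => [[/andP[b_gt0 ba] _] _].
move: hf => [f_cont f0 f_gt0].
move: hl1; rewrite lt_min => /andP[lH lFa].
have fHP y : 0 <= y <= H -> f y <= fH.
  by move=> yH; apply: hfH.2; exists y => //; rewrite /= in_itv.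
have fH0 : 0 < fH.
  by rewrite (lt_le_trans (f_gt0 _ ha))// fHP// !ltW.
(* Equality would give [l < F a = F b < - l]. *)
have {}ba : b < a.
  rewrite lt_neqAle ba andbT; apply/eqP => ab.
  by move: lFa hl2 hl; rewrite /Fdiff ab; lra.
have lFa' : - l < Fdiff f a by rewrite (lt_trans _ lFa)// gtrN.
have bv := v_ge ba lFa'.
have ua : u_ f a l <= a.
  apply: ge_sup => [|y /= [/andP[_ /ltW]]//].
  by exists 0; rewrite /= lexx ha /Fdiff f0 subrr.
move: hx0 => /andP[vx0 x0u].
have x0_ge0 : 0 <= x0 by rewrite ltW// (le_lt_trans _ vx0)// (le_trans (ltW b_gt0)).
have Fx0l : Fdiff f x0 < l.
  have [y [xy yu]] := u_gt f0 ha hl x0u; apply: le_lt_trans.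
  by apply: hF; rewrite ?in_itv /= ?yu ?(ltW vx0) ?(ltW x0u) ?(ltW xy)//
    (le_trans (ltW vx0) (ltW xy)).
have lFx0 : - l < Fdiff f x0.
  have [y [xy vy]] := v_lt ba lFa' vx0; move/lt_le_trans; apply.
  by apply: hF; rewrite ?in_itv /= ?vy ?(ltW vx0) ?(ltW x0u) ?(ltW xy)//
    (le_trans (ltW xy) (ltW x0u)).
have F_up : {in `[x0, u_ f a l] &, {homo Fdiff f : y z / y <= z}}.
  move=> y z; rewrite !in_itv /= => /andP[x0y yu] /andP[x0z zu]; apply: hF.
    by rewrite in_itv /= yu (le_trans (ltW vx0)).
  by rewrite in_itv /= zu (le_trans (ltW vx0)).
have F_down : {in `[v_ f b l, x0] &, {homo Fdiff f : y z / y <= z}}.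
  move=> y z; rewrite !in_itv /= => /andP[vy yx0] /andP[vz zx0]; apply: hF.
    by rewrite in_itv /= vy (le_trans yx0)// ltW.
  by rewrite in_itv /= vz (le_trans zx0)// ltW.
have x0H : 0 <= x0 <= H by rewrite x0_ge0 (le_trans (ltW x0u))// (le_trans ua)// ltW.
move=> x persist_bound entry_bound Ppersist Penter Pstay.
(* Shared by the last two claims: the second needs exactly this, and the third starts from the entry
   time. *)
have enter_ae : \forall w \ae P,
    (forall i, (i < K2 f b l x0)%N -> chi i w < -1 + delta_ f l x0 i.+1) ->
    enters `[0, b] (x w).
  apply: filterS2 (noise_bounded hchi) (noise_infinitely_often_lt0 hchi).
  by move=> w chi1 chi_lt0; apply: solution_enters.
pose below i := [set y : R | y < -1 + delta_ f l x0 i].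
have m_below i : measurable (below i).
  by rewrite /below -set_itvNyo; exact: measurable_itv.
have below_gt0 i : (i < K2 f b l x0)%N -> (0 < P (chi 0%N @^-1` below i.+1))%E.
  move=> /(delta_gt0 hl F_down vx0 Fx0l) di_gt0.
  (* The minimum with 0 keeps the test interval inside [[-1, 1]] however large [delta_] is. *)
  apply: (noise_gt0 hchi _ (r := -1) (s := Num.min 0 (-1 + delta_ f l x0 i.+1))) => //.
  - by rewrite lt_min ltrN10 ltrDl.
  - by rewrite ge_min ler01.
  - by move=> y; rewrite /= in_itv /= lt_min => /and3P[].
split.
- apply: (noise_forcing hchi (K := K1 f a l x0)
    (A := fun i => [set y : R | 1 - eps_ f l x0 i < y])).
  + by move=> i; rewrite -set_itvoy; exact: measurable_itv.
  + exact: measurable_persistent.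
  + move=> i /(eps_gt0 hl F_up lFx0) /(_ x0u) ei_gt0.
    (* Likewise, the maximum with 0 keeps the left end above -1 however large [eps_] is. *)
    apply: (noise_gt0 hchi _ (r := Num.max 0 (1 - eps_ f l x0 i.+1)) (s := 1)) => //.
    * by rewrite -set_itvoy; exact: measurable_itv.
    * by rewrite le_max lerN10.
    * by rewrite gt_max ltr01 gtrBl.
    * by move=> y; rewrite /= in_itv /= gt_max => /andP[/andP[]].
  + apply: filterS (noise_bounded hchi) => w chi1.
    apply: (persistent_solution hl chi1 (H := H)) => //.
      exact: solution_bound fHP.
    by rewrite (lt_trans _ x0u)// (lt_le_trans b_gt0)// (le_trans bv)// ltW.
- apply: (noise_forcing hchi (A := below)) => //.
  by apply: measurable_enters => //; exact: measurable_itv.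
move=> fb; apply: (noise_forcing hchi (A := below)) => //.
  by apply: measurable_stays_eventually => //; exact: measurable_itv.
apply: filterS2 (noise_bounded hchi) enter_ae => w chi1 + wbelow => /(_ wbelow).
apply: solution_stays => // y /andP[].
(* The bound by [f b] is assumed on the open interval only; at 0 it follows from [f 0 = 0 < f b]. *)
rewrite le_eqVlt => /predU1P[<- _|y0]; first by rewrite f0 ltW// f_gt0.
by rewrite le_eqVlt => /predU1P[->//|yb]; rewrite fb// y0.
Qed.
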